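(* Let $S_i$ and $\tilde S_i^{(t-i+1)}$ be two joint distributions over $\mathcal{X}\times\mathcal{Y}$. Let $h_i=\arg\min_{h\in\mathcal{H}}\mathrm{R}(h,S_i)$ and $\tilde h_i^{(t-i+1)}=\arg\min_{h\in\mathcal{H}}\mathrm{R}(h,\tilde S_i^{(t-i+1)})$ represent the ideal classifiers for $S_i$ and $\tilde S_i^{(t-i+1)}$, respectively, where $\mathcal{H}$ is the classifier space and $\mathrm{R}$ is the empirical risk. Suppose the loss $\tau:\mathcal{Y}\times\mathcal{Y}\to[0,1]$ is symmetric, bounded and obeys the triangle inequality. Then, for a classifier $h\in\mathcal{H}$, $$\mathrm{R}(h,S_i)\le \mathrm{R}'\big(h,\tilde h_i^{(t-i+1)},\tilde S_i^{(t-i+1)}\big)+\Psi\big(S_{i,\mathcal{X}},\tilde S_{i,\mathcal{X}}^{(t-i+1)}\big)+\sigma\big(S_i,\tilde S_i^{(t-i+1)}\big),$$ where the optimal combined error is $$\sigma\big(S_i,\tilde S_i^{(t-i+1)}\big)=\mathrm{R}'(h_i^*,h_i,S_i)+\mathrm{R}'\big(h_i,\tilde h_i^{(t-i+1)},\tilde S_i^{(t-i+1)}\big),$$ with $$\mathrm{R}'(h_i^*,h_i,S_i)=\mathbb{E}_{\mathbf{x}\sim S_{i,\mathcal{X}}}\,\tau\big(h_i^*(\mathbf{x}),h_i(\mathbf{x})\big),$$ and $h_i^*$ is the true labeling function for $S_i$.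
   Context: $\mathcal{X}$ is the input space and $\mathcal{Y}$ the output space ($\{-1,1\}$ for binary classification, $\{1,\dots,n'\}$ with $n'>2$ for multi-class classification). $\mathcal{H}$ is the space of all classifiers $\mathcal{X}\to\mathcal{Y}$. Bounded means $\tau(y,y')\le M'$ for all $(y,y')\in\mathcal{Y}^2$, where $M'$ is a positive number. Empirical risk: for a joint distribution $P$ on $\mathcal{X}\times\mathcal{Y}$, draw $n$ paired samples $(\mathbf{x}_j,y_j)\sim P$; the empirical risk of a classifier $h\in\mathcal{H}$ is $\mathrm{R}(h,P)=\frac1n\sum_{j=1}^n\tau(h(\mathbf{x}_j),y_j)$. For classifiers $f,g$ and a joint distribution $P$ with marginal $P_{\mathcal{X}}$ on $\mathcal{X}$: $\mathrm{R}'(f,g,P)=\mathbb{E}_{\mathbf{x}\sim P_{\mathcal{X}}}\tau(f(\mathbf{x}),g(\mathbf{x}))$. Discrepancy distance between two marginals on $\mathcal{X}$: $$\Psi(P_{\mathcal{X}},Q_{\mathcal{X}})=\sup_{(h,h')\in\mathcal{H}^2}\Big|\mathbb{E}_{P_{\mathcal{X}}}[\tau(h'(\mathbf{x}),h(\mathbf{x}))]-\mathbb{E}_{Q_{\mathcal{X}}}[\tau(h'(\mathbf{x}),h(\mathbf{x}))]\Big|.$$ Distributions: a model consisting of a generator $g_{\theta^t}$, a classifier $h_{\varsigma^t}$ and a task-inference network $U_\varphi$ is trained successively on training sets $D_S^1,\dots,D_S^t$ of $t$ tasks, using generative replay (earlier tasks are re-learnt from samples generated by the model itself). $S_i$ is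 the joint distribution characterizing the testing set of the $i$-th task, with marginal $S_{i,\mathcal{X}}$. $\tilde S^t$ is the joint distribution approximated by the generator and classifier after learning task $t$. The task-inference network is assumed to predict the task label of a sample exactly, and $\tilde S_i^{(t-i+1)}$ consists of the pairs $\{\mathbf{x},h_{\varsigma^t}(\mathbf{x})\}\sim\tilde S^t$ with $U_\varphi(\mathbf{x})=i$; its marginal is $\tilde S_{i,\mathcal{X}}^{(t-i+1)}$. The superscript $(t-i+1)$ indicates the number of times the data of task $i$ has been refined through the generative replay processes after the $t$-th task learning; superscript $1$ means the samples come from $D_S^i$.
   Formalization: The empirical risk R(h,P) is taken as its mean over the draw of the samples (equal to the sample average when P is the empirical distribution of a fixed data set), since the bound fails for individual random draws; classifiers are measurable. *)

(* Defs.v *)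
From HB Require Import structures.
From mathcomp Require Import all_boot all_order all_algebra.
From mathcomp Require Import all_classical all_reals all_analysis.

Set Implicit Arguments.
Unset Strict Implicit.
Unset Printing Implicit Defensive.

Import Order.TTheory GRing.Theory Num.Theory.

Local Open Scope classical_set_scope.
Local Open Scope ring_scope.
Local Open Scope ereal_scope.

HB.instance Definition _ d1 d2 (T1 : measurableType d1)
    (T2 : measurableType d2) :=
  isMeasurableFun.Build _ _ (T1 * T2)%type T1 fst measurable_fst.

Definition marginal dX dY (X : measurableType dX) (Y : measurableType dY)
    (R : realType) (P : probability (X * Y)%type R) : probability X R :=
  distribution P (fst : {mfun (X * Y)%type >-> X}).

(* Classifiers are the measurable maps X -> Y: without measurability the
   expectations below have no meaning. *)
Notation classifier X Y := {mfun X >-> Y}.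

Definition empirical_risk (X Y : Type) (R : realType) (tau : Y -> Y -> R)
    (n : nat) (s : 'I_n -> X * Y) (h : X -> Y) : R :=
  (n%:R^-1 * \sum_(j < n) tau (h (s j).1) (s j).2)%R.

(* [samples P] is a way of drawing n > 0 items from P. It is only required that
   the laws of the n items average to P. This holds when every item has law P,
   in particular for n independent draws [samples_drawn], and also when the
   items are a fixed data set whose empirical distribution is P
   [samples_fixed]. *)
Record samples d (T : measurableType d) (R : realType) (P : probability T R) :=
  Samples {
    smp_display : measure_display;
    smp_space : measurableType smp_display;
    smp_prob : probability smp_space R;
    smp_size : nat;
    smp_size_gt0 : (0 < smp_size)%N;
    smp_item : 'I_smp_size -> {mfun smp_space >-> T};
    smp_law : forall A : set T, measurable A ->
      (smp_size%:R^-1)%:E * (\sum_(j < smp_size)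
        distribution smp_prob (smp_item j) A) = P A }.

Arguments smp_item {d T R P} s j : rename.

(* The empirical risk on a random draw is a random variable; R(h, P), which
   depends on h and P only, is its mean over the draw. For a fixed data set
   this is the empirical risk itself, see [risk_fixed]. *)
Definition risk dX dY (X : measurableType dX) (Y : measurableType dY)
    (R : realType) (tau : Y -> Y -> R) (P : probability (X * Y)%type R)
    (D : samples P) (h : classifier X Y) : \bar R :=
  'E_(smp_prob D)[fun w => empirical_risk tau (fun j => smp_item D j w) h].

Definition risk' dX dY (X : measurableType dX) (Y : measurableType dY)
    (R : realType) (tau : Y -> Y -> R) (f g : classifier X Y)
    (P : probability (X * Y)%type R) : \bar R :=
  'E_(marginal P)[fun x => tau (f x) (g x)].

Definition discrepancy dX dY (X : measurableType dX) (Y : measurableType dY)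
    (R : realType) (tau : Y -> Y -> R) (PX QX : probability X R) : \bar R :=
  ereal_sup [set z | exists h h' : classifier X Y,
    z = `| 'E_PX[fun x => tau (h' x) (h x)]
           - 'E_QX[fun x => tau (h' x) (h x)] | ].

Definition is_argmin (H : Type) (R : realType) (r : H -> \bar R) (h : H) :=
  forall g : H, r h <= r g.

Definition true_labeling dX dY (X : measurableType dX) (Y : measurableType dY)
    (R : realType) (P : probability (X * Y)%type R) (h : classifier X Y) :=
  {ae P, forall z, z.2 = h z.1}.

Definition sigma dX dY (X : measurableType dX) (Y : measurableType dY)
    (R : realType) (tau : Y -> Y -> R) (hstar h h' : classifier X Y)
    (S S' : probability (X * Y)%type R) : \bar R :=
  risk' tau hstar h S + risk' tau h h' S'.

Section samples_instances.
Context d (T : measurableType d) (R : realType) (P : probability T R).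

Lemma samples_drawn_law d' (W : measurableType d') (Pr : probability W R)
    (n : nat) (n_gt0 : (0 < n)%N) (Z : 'I_n -> {mfun W >-> T})
    (ZP : forall j (A : set T), measurable A -> distribution Pr (Z j) A = P A)
    (A : set T) : measurable A ->
  (n%:R^-1)%:E * (\sum_(j < n) distribution Pr (Z j) A) = P A.
Proof.
move=> mA; rewrite (eq_bigr (fun=> P A)); last by move=> j _; exact: ZP.
have /fineK <- : P A \is a fin_num by exact: fin_num_measure.
rewrite sumEFin -EFinM sumr_const card_ord -[(fine _ *+ n)%R]mulr_natl mulrA.
by rewrite mulVf ?mul1r// pnatr_eq0 -lt0n.
Qed.

Definition samples_drawn d' (W : measurableType d') (Pr : probability W R)
    (n : nat) (n_gt0 : (0 < n)%N) (Z : 'I_n -> {mfun W >-> T})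
    (ZP : forall j (A : set T), measurable A -> distribution Pr (Z j) A = P A) :
  samples P := Samples n_gt0 (samples_drawn_law n_gt0 ZP).

Lemma samples_fixed_law (n : nat) (s : 'I_n -> T)
    (sP : forall A : set T, measurable A ->
      P A = (n%:R^-1)%:E * \sum_(j < n) \d_(s j) A)
    (A : set T) : measurable A ->
  (n%:R^-1)%:E * (\sum_(j < n)
    distribution (\d_tt : probability unit R)
      (cst (s j) : {mfun unit >-> T}) A) = P A.
Proof.
by move=> mA; rewrite sP//; congr (_ * _); apply: eq_bigr => j _.
Qed.

Definition samples_fixed (n : nat) (n_gt0 : (0 < n)%N) (s : 'I_n -> T)
    (sP : forall A : set T, measurable A ->
      P A = (n%:R^-1)%:E * \sum_(j < n) \d_(s j) A) :
  samples P := Samples n_gt0 (samples_fixed_law sP).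

End samples_instances.

Lemma risk_fixed dX dY (X : measurableType dX) (Y : measurableType dY)
    (R : realType) (tau : Y -> Y -> R) (P : probability (X * Y)%type R)
    (n : nat) (n_gt0 : (0 < n)%N) (s : 'I_n -> X * Y)
    (sP : forall A : set (X * Y), measurable A ->
      P A = (n%:R^-1)%:E * \sum_(j < n) \d_(s j) A) (h : classifier X Y) :
  risk tau (samples_fixed n_gt0 sP) h = (empirical_risk tau s h)%:E.
Proof. by rewrite /risk /=; exact: expectation_cst. Qed.

(* Main.v *)
(* The laws of the drawn items average to P, so the mean empirical risk is the
   integral of the loss against P, and the true labeling turns it into
   R'(h, h*, S). The triangle inequality of tau passes to R', through h_i on S
   and through the ideal classifier of S' on S'; the passage of R'(h, h_i, .)
   from S to S' costs at most the discrepancy. *)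
Require Import Defs.
From mathcomp Require Import all_boot all_order all_algebra.
From mathcomp Require Import all_classical all_reals all_analysis.
From mathcomp Require Import measurable_realfun.

Set Implicit Arguments.
Unset Strict Implicit.
Unset Printing Implicit Defensive.

Import Order.TTheory GRing.Theory Num.Theory.

Local Open Scope classical_set_scope.
Local Open Scope ring_scope.
Local Open Scope ereal_scope.

(** Splitting on the finitely many values [y] of [f] freezes the first argument of [tau]. What
    remains is the preimage under [g] of some subset of [Y], and every such subset is measurable. *)
Lemma measurable_fun_finite_discrete2 d dY dZ (W : measurableType d)
    (Y : measurableType dY) (Z : measurableType dZ) (tau : Y -> Y -> Z)
    (f g : W -> Y) :
  finite_set [set: Y] -> (forall A : set Y, measurable A) ->
  measurable_fun setT f -> measurable_fun setT g ->
  measurable_fun setT (fun w => tau (f w) (g w)).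
Proof.
move=> Yfin Ydisc mf mg _ A mA; rewrite setTI.
have -> : (fun w => tau (f w) (g w)) @^-1` A =
    \bigcup_y ((f @^-1` [set y]) `&` (g @^-1` (tau y @^-1` A))).
  by apply/seteqP; split=> [w Aw|w [y _ [/= <-]]//]; exists (f w).
apply: fin_bigcup_measurable => // y _; apply: measurableI.
- by rewrite -[X in measurable X]setTI; exact: mf.
- by rewrite -[X in measurable X]setTI; exact: mg.
Qed.

(** By [smp_law], [P] coincides on measurable sets with the average of the laws of the items.
    Integration is additive in the measure, and each law is a pushforward, so a change of variables
    finishes. *)
Lemma ge0_integral_samples d (T : measurableType d) (R : realType)
    (P : probability T R) (D : samples P) (f : T -> \bar R) :
  measurable_fun setT f -> (forall x, 0 <= f x) ->
  \int[P]_x f x = ((smp_size D)%:R^-1)%:E *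
    \sum_(j < smp_size D) \int[smp_prob D]_w f (smp_item D j w).
Proof.
move=> mf f0; set n := smp_size D.
(* [msum] sums a sequence indexed by [nat], so indices from [n] on need a default item. Item 0
   exists since [n > 0]; the sum stops before the default is reached. *)
pose ord (j : nat) : 'I_n := insubd (Ordinal (smp_size_gt0 D)) j.
pose m j : measure T R := distribution (smp_prob D) (smp_item D (ord j)).
have ordE (j : 'I_n) : ord j = j by apply/val_inj; rewrite val_insubd ltn_ord.
have n0 : (0 <= n%:R^-1 :> R)%R by rewrite invr_ge0.
rewrite (eq_measure_integral (mscale (NngNum n0) (msum m n))); last first.
  move=> A mA _; rewrite -[LHS](smp_law D mA) /= /mscale /msum /=.
  congr (_ * _).
  by apply: eq_bigr => j _; rewrite /m ordE.
rewrite ge0_integral_mscale// ge0_integral_measure_sum//; congr (_ * _).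
by apply: eq_bigr => j _; rewrite /m ordE ge0_integral_distribution.
Qed.

Section bounded_loss.
Context (R : realType) (dX dY : measure_display) (X : measurableType dX)
  (Y : measurableType dY).
Hypothesis Y_finite : finite_set [set: Y].
Hypothesis Y_discrete : forall A : set Y, measurable A.
Variable tau : Y -> Y -> R.
Hypothesis tau_01 : forall y y', (0 <= tau y y' <= 1)%R.

Let tau_ge0 y y' : 0 <= (tau y y')%:E.
Proof. by have /andP[] := tau_01 y y'; rewrite lee_fin. Qed.

Let measurable_tau d (W : measurableType d) (f g : W -> Y) :
  measurable_fun setT f -> measurable_fun setT g ->
  measurable_fun setT (fun w => (tau (f w) (g w))%:E).
Proof.
by move=> mf mg; apply/measurable_EFinP; exact: measurable_fun_finite_discrete2.
Qed.

Let measurable_tau_mfun d (W : measurableType d) (f g : {mfun W >-> Y}) :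
  measurable_fun setT (fun w => (tau (f w) (g w))%:E).
Proof. exact: measurable_tau. Qed.

(** By linearity of the integral, the mean empirical risk depends only on the individual laws of the
    items, not on their joint law. *)
Lemma risk_integral (P : probability (X * Y)%type R) (D : samples P)
    (h : classifier X Y) :
  risk tau D h = \int[P]_z (tau (h z.1) z.2)%:E.
Proof.
have mtau : measurable_fun setT (fun z : X * Y => (tau (h z.1) z.2)%:E).
  by apply: measurable_tau => //; exact: measurableT_comp.
rewrite (ge0_integral_samples D)// /risk unlock /empirical_risk.
rewrite -ge0_integral_sum//; last first.
  by move=> j; exact: (measurableT_comp mtau).
rewrite -ge0_integralZl//.
- by apply: eq_integral => w _; rewrite sumEFin.
- by apply: emeasurable_sum => j; exact: (measurableT_comp mtau).
- by move=> w _; exact: sume_ge0.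
Qed.

(** Moves from the marginal back to pairs, where the integrand can be compared almost everywhere
    with that of [risk_integral]. *)
Lemma risk'E (f g : classifier X Y) (P : probability (X * Y)%type R) :
  risk' tau f g P = \int[P]_z (tau (f z.1) (g z.1))%:E.
Proof. by rewrite /risk' unlock ge0_integral_distribution. Qed.

Lemma risk_true_labeling (P : probability (X * Y)%type R) (D : samples P)
    (hstar h : classifier X Y) :
  true_labeling P hstar -> risk tau D h = risk' tau h hstar P.
Proof.
move=> hstarP; rewrite risk_integral risk'E; apply: ge0_ae_eq_integral => //.
- by apply: measurable_tau => //; exact: measurableT_comp.
- by apply: measurable_tau; exact: measurableT_comp.
- by apply: filterS hstarP => z -> _.
Qed.

(** A loss at most 1 has mean at most 1. Finiteness makes it legitimate to subtract and add back a
    term in [\bar R]. *)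
Lemma risk'_fin_num (f g : classifier X Y) (P : probability (X * Y)%type R) :
  risk' tau f g P \is a fin_num.
Proof.
rewrite /risk' unlock ge0_fin_numE ?integral_ge0//.
apply: (@le_lt_trans _ _ (\int[marginal P]_x (cst 1) x)); last first.
  by rewrite integral_cst// mul1e ltey_eq fin_num_measure.
apply: ge0_le_integral => // x _.
by have /andP[] := tau_01 (f x) (g x); rewrite lee_fin.
Qed.

Lemma risk'_sym (f g : classifier X Y) (P : probability (X * Y)%type R) :
  (forall y y', tau y y' = tau y' y) -> risk' tau f g P = risk' tau g f P.
Proof. by move=> sym; congr ('E__[_]); apply/funext => x; exact: sym. Qed.

Lemma risk'_triangle (g f h : classifier X Y)
    (P : probability (X * Y)%type R) :
  (forall y1 y2 y3, (tau y1 y3 <= tau y1 y2 + tau y2 y3)%R) ->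
  risk' tau f h P <= risk' tau f g P + risk' tau g h P.
Proof.
move=> tri; rewrite /risk' unlock -ge0_integralD//.
apply: ge0_le_integral => //; first exact: emeasurable_funD.
by move=> x _; rewrite -EFinD lee_fin.
Qed.

Lemma risk'_le_discrepancy (f g : classifier X Y)
    (P Q : probability (X * Y)%type R) :
  risk' tau f g P <=
    risk' tau f g Q + discrepancy tau (marginal P) (marginal Q).
Proof.
rewrite -[leLHS](subeK _ (risk'_fin_num f g Q)) addeC leeD2l//.
(* The witnesses are swapped because [discrepancy] evaluates [tau (h' x) (h x)]. *)
by apply: (le_trans (lee_abs _)); apply: ereal_sup_ubound; exists g, f.
Qed.

End bounded_loss.

Theorem theorem1 (R : realType) (dX dY : measure_display)
    (X : measurableType dX) (Y : measurableType dY)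
    (k : nat) (k_gt1 : (1 < k)%N) (Y_card : ([set: Y] #= `I_k)%card)
    (Y_discrete : forall A : set Y, measurable A)
    (tau : Y -> Y -> R)
    (tau_01 : forall y y', (0 <= tau y y' <= 1)%R)
    (tau_sym : forall y y', tau y y' = tau y' y)
    (M' : R) (M'_gt0 : (0 < M')%R)
    (tau_bounded : forall y y', (tau y y' <= M')%R)
    (tau_triangle : forall y1 y2 y3, (tau y1 y3 <= tau y1 y2 + tau y2 y3)%R)
    (Stest : nat -> probability (X * Y)%type R)
    (Sgen : nat -> nat -> probability (X * Y)%type R)
    (t i : nat) (i_ge1 : (1 <= i)%N) (i_le_t : (i <= t)%N)
    (D : samples (Stest i)) (D' : samples (Sgen i (t - i + 1)%N))
    (hstar : classifier X Y) (hstarP : true_labeling (Stest i) hstar)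
    (hi : classifier X Y) (hiP : is_argmin (risk tau D) hi)
    (hi' : classifier X Y) (hi'P : is_argmin (risk tau D') hi')
    (h : classifier X Y) :
  risk tau D h <=
    risk' tau h hi' (Sgen i (t - i + 1)%N)
    + discrepancy tau (marginal (Stest i)) (marginal (Sgen i (t - i + 1)%N))
    + sigma tau hstar hi hi' (Stest i) (Sgen i (t - i + 1)%N).
Proof.
have Y_finite : finite_set [set: Y] by exists k.
have risk'C f g P := @risk'_sym R _ _ X Y tau f g P tau_sym.
have risk'D f g h' P :=
  @risk'_triangle R _ _ X Y Y_finite Y_discrete tau tau_01 g f h' P
    tau_triangle.
rewrite (risk_true_labeling Y_finite Y_discrete tau_01 D h hstarP) /sigma.
apply: (le_trans (risk'D h hi hstar _)).
(* Symmetry matches the first term of [sigma], which is then cancelled, and orients the second for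
   the path from [h] through [hi'] to [hi]. *)
rewrite (risk'C hi hstar) (risk'C hi hi') [in leRHS]addeCA [in leLHS]addeC.
apply: leeD2l.
apply: (le_trans (risk'_le_discrepancy Y_finite Y_discrete tau_01 h hi _
  (Sgen i (t - i + 1)%N))).
by rewrite addeAC leeD2r.
Qed.
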